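(* Let $h\ge 2$ and $n\ge 1$ be integers and let $H$ be an $h$-uniform hypergraph. If $H$ is $n$-e.c., then $H$ has at least $n2^{n-1}$ edges and at least $n+\ell$ vertices, where $\ell$ is the smallest positive integer such that $\binom{\ell}{h-1}\geq 2^n$.
   Context: A hypergraph $H=(V,E)$ consists of a finite vertex set $V$ and a collection $E$ of subsets of $V$ (edges); it is $h$-uniform if every edge has exactly $h$ vertices. For a positive integer $n$, an $h$-uniform hypergraph $H$ is $n$-existentially closed ($n$-e.c.) if for every set $S\subseteq V(H)$ with $|S|=n$ and every $T\subseteq S$, there is a set $X\subseteq V(H)\setminus S$ with $|X|=h-1$ such that $X\cup\{z\}$ is an edge of $H$ for every $z\in T$ and $X\cup\{s\}$ is not an edge of $H$ for every $s\in S\setminus T$.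
   Formalization: The hypergraph is additionally assumed to have at least n vertices; with fewer, it is vacuously n-e.c. and the claimed vertex bound fails (e.g. the empty hypergraph with n = 1). *)

(* Defs.v *)
From mathcomp Require Import all_boot.

Set Implicit Arguments.
Unset Strict Implicit.
Unset Printing Implicit Defensive.

(* A hypergraph is given by its vertex type [V] and its edge set
   [E : {set {set V}}]. *)

Definition uniform (V : finType) (h : nat) (E : {set {set V}}) : Prop :=
  forall e : {set V}, e \in E -> #|e| = h.

(* The case #|V| < n is not excluded here; there the condition is vacuous. *)
Definition ec (V : finType) (h n : nat) (E : {set {set V}}) : Prop :=
  forall S : {set V}, #|S| = n ->
  forall T : {set V}, T \subset S ->
  exists X : {set V},
    [/\ X \subset ~: S,
        #|X| = h - 1,
        forall z : V, z \in T -> X :|: [set z] \in E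
      & forall s : V, s \in S :\: T -> X :|: [set s] \notin E].

Definition smallest_pos (P : nat -> Prop) (l : nat) : Prop :=
  [/\ 0 < l, P l & forall k : nat, 0 < k -> P k -> l <= k].

(* Main.v *)
Require Import Defs.
From mathcomp Require Import all_boot.

Set Implicit Arguments.
Unset Strict Implicit.
Unset Printing Implicit Defensive.

(* Fix S with |S| = n.  Being n-e.c. says that every T \subset S is the trace
   {z in S | X + z is an edge} of some (h-1)-set X avoiding S.  Hence there are
   at least 2^n such X among the 'C(|V| - n, h - 1) candidates.  An edge X + z
   with z in S determines z and X, hence the trace T of X, so for each z in S
   the 2^(n-1) subsets T containing z give as many edges meeting S in {z}. *)

Definition trace (V : finType) (E : {set {set V}}) (S X : {set V}) : {set V} :=
  [set z in S | X :|: [set z] \in E].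

Lemma ec_trace (V : finType) (h n : nat) (E : {set {set V}}) (S T : {set V}) :
  ec h n E -> #|S| = n -> T \subset S ->
  exists X : {set V},
    [/\ X \subset ~: S, #|X| = h - 1 & trace E S X = T].
Proof.
move=> hec cS sTS; have [X [sX cX edgeT nedgeT]] := hec S cS T sTS.
exists X; split=> //; apply/setP=> z; rewrite inE.
have [zT|zT] := boolP (z \in T); first by rewrite (subsetP sTS) ?edgeT.
have [zS|//] := boolP (z \in S).
by apply/negbTE/nedgeT; rewrite in_setD zT.
Qed.

Lemma ec_bin (V : finType) (h n : nat) (E : {set {set V}}) (S : {set V}) :
  ec h n E -> #|S| = n -> 2 ^ n <= 'C(#|V| - n, h - 1).
Proof.
move=> hec cS; rewrite -cS -card_powerset -(cardsC S) addKn -cards_draws.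
(* [trace E S] maps the (h-1)-subsets of [~: S] onto the powerset of [S]. *)
apply: leq_trans (leq_imset_card (trace E S) _).
apply/subset_leq_card/subsetP=> T; rewrite inE => sTS.
have [X [sX cX <-]] := ec_trace hec cS sTS.
by apply: imset_f; rewrite inE sX cX eqxx.
Qed.

Lemma ec_edges_at (V : finType) (h n : nat) (E : {set {set V}}) (S : {set V})
    (z : V) :
  ec h n E -> #|S| = n -> z \in S ->
  2 ^ (n - 1) <= #|[set e in E | e :&: S == [set z]]|.
Proof.
move=> hec cS zS.
have <- : #|S :\ z| = n - 1 by rewrite -cS (cardsD1 z S) zS addKn.
rewrite -card_powerset.
(* This map sends the edges meeting [S] only in [z] onto the powerset of [S :\ z]: a subset [T]
   comes from [z |: X], where [X] has trace [z |: T]. Having [z] in the trace is what makes [z |: X]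
   an edge. *)
apply: leq_trans (leq_imset_card (fun e => trace E S (e :\ z) :\ z) _).
apply/subset_leq_card/subsetP=> T; rewrite inE => /subsetD1P[sTS zT].
have sUS : z |: T \subset S by rewrite subUset sub1set zS.
have [X [sX _ trX]] := ec_trace hec cS sUS.
have zX : z \notin X by apply: contraTN zS => /(subsetP sX); rewrite inE.
apply/imsetP; exists (z |: X); last by rewrite setU1K // trX setU1K.
have: z \in trace E S X by rewrite trX setU11.
rewrite !inE setUC => /andP[_ ->] /=.
have /eqP XS0 : X :&: S == set0 by rewrite setI_eq0 disjoints_subset.
by rewrite setIUl XS0 setU0 (setIidPl _) ?sub1set.
Qed.

(** The families of [ec_edges_at] for distinct [z] are disjoint, since [e :&: S] equals at most one
    singleton. Exchanging the sums over [z] and [e] thus counts each edge at most once. *)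
Lemma ec_edges (V : finType) (h n : nat) (E : {set {set V}}) (S : {set V}) :
  ec h n E -> #|S| = n -> n * 2 ^ (n - 1) <= #|E|.
Proof.
move=> hec cS; rewrite -{1}cS -sum_nat_const.
apply: leq_trans (leq_sum _ (fun z => ec_edges_at hec cS)) _.
under eq_bigr do rewrite -sum1dep_card big_mkcondr.
rewrite exchange_big -sum1_card leq_sum //= => e _.
have [/existsP[z /eqP eS]|/existsPn no_z] :=
    boolP [exists z, e :&: S == [set z]].
  have zS : z \in S by apply: (subsetP (subsetIr e S)); rewrite eS set11.
  rewrite (bigD1 z) //= eS eqxx big1 // => y /andP[_ /negbTE yz].
  by rewrite (inj_eq set1_inj) eq_sym yz.
by rewrite big1 // => z _; rewrite (negbTE (no_z z)).
Qed.

Theorem theorem3 (h n : nat) (V : finType) (E : {set {set V}})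
  (hh : 2 <= h) (hn : 1 <= n) (hV : n <= #|V|)
  (hunif : uniform h E) (hec : ec h n E) :
  n * 2 ^ (n - 1) <= #|E| /\
  exists l : nat,
    smallest_pos (fun k => 2 ^ n <= 'C(k, h - 1)) l /\ n + l <= #|V|.
Proof.
have [S cS] : exists S : {set V}, #|S| = n.
  have /card_geqP[s [us ss _]] := hV.
  by exists [set x in s]; rewrite cardsE (card_uniqP us).
split; first exact: ec_edges hec cS.
pose P k := (0 < k) && (2 ^ n <= 'C(k, h - 1)).
(* Positivity: a nonzero binomial forces [h - 1 <= #|V| - n], and [h - 1] is positive as
   [2 <= h]. *)
have PV : P (#|V| - n).
  have binV := ec_bin hec cS; rewrite /P binV andbT.
  have: 0 < 'C(#|V| - n, h - 1) by rewrite (leq_trans _ binV) ?expn_gt0.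
  by rewrite bin_gt0; apply: leq_trans; rewrite subn_gt0.
case: (ex_minnP (ex_intro P _ PV)) => l /andP[l_gt0 binl] minl.
exists l; split; last by rewrite -leq_subRL // minl.
by split=> // k k_gt0 bink; apply: minl; rewrite /P k_gt0.
Qed.
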